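(* Let $N \in \mathbb{N}$, let $\mathbb{K}$ be a field, let $A_1, \ldots, A_N$ be finite subsets of $\mathbb{K}$, and let $\mathbf{a} = (a_1, \ldots, a_N) \in (A_1 \setminus \{0\}) \times \cdots \times (A_N \setminus \{0\})$. Let $f \in \mathbb{K}[X_1, \ldots, X_N]$ be a polynomial such that $\deg_{X_i}(f) < |A_i|$ for all $i \in \{1,\ldots,N\}$, and let $Q := A_1 \times \cdots \times A_N$. Assume that $f$ is absorbing at $\mathbf{a}$ for $Q$, and that there is $\mathbf{b} \in Q$ with $f(\mathbf{b}) \neq 0$. Then $M(f) \ge 2^N$.
   Context: $\mathbb{N}$ denotes the set of positive integers. $\deg_{X_i}(f)$ is the degree of $f$ in the variable $X_i$. $M(f)$ denotes the number of monomials that appear in $f$ with nonzero coefficient. For $Q = A_1 \times \cdots \times A_N$ and $\mathbf{a} \in Q$, the polynomial $f$ is called absorbing at $\mathbf{a}$ for $Q$ if for all $(x_1,\ldots,x_N) \in Q$: if there is $i \in \{1,\ldots,N\}$ with $x_i = a_i$, then $f(x_1,\ldots,x_N) = 0$. *)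

(* Defs.v *)
From HB Require Import structures.
From mathcomp Require Import all_boot all_order all_algebra.
From mathcomp Require Export finmap.
From mathcomp.multinomials Require Export mpoly.

Set Implicit Arguments.
Unset Strict Implicit.
Unset Printing Implicit Defensive.

Import GRing.Theory.

Local Open Scope ring_scope.

(* Points of K^N are functions 'I_N -> K, as [meval] expects. *)
Definition box (N : nat) (K : choiceType) (A : 'I_N -> {fset K}) :
    {pred 'I_N -> K} :=
  fun x => [forall i, x i \in A i].

(* The zero polynomial gets degree 0. *)
Definition mdegvar (N : nat) (K : nzRingType) (i : 'I_N)
    (f : {mpoly K[N]}) : nat :=
  (\max_(m <- msupp f) m i)%N.

Definition nmonomials (N : nat) (K : nzRingType) (f : {mpoly K[N]}) : nat :=
  size (msupp f).

Definition absorbing (N : nat) (K : nzRingType) (f : {mpoly K[N]})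
    (a : 'I_N -> K) (Q : {pred 'I_N -> K}) : Prop :=
  forall x : 'I_N -> K, x \in Q -> (exists i, x i = a i) -> f.@[x] = 0.

(* Main.v *)
(** The support of [f] is never alone on an axis-parallel line: if [m] is in the
    support, then for every coordinate [i] some other monomial of the support
    agrees with [m] outside [i].  Indeed, since the degrees are below the sizes
    of the [A j], dual Vandermonde weights on [A j] extract the exponent [m j];
    using them in all directions [j != i], and evaluation at [a i] in direction
    [i], expresses the sum of the [f@_m' * a i ^+ m' i] over the line through
    [m] as a combination of values of [f] on the hyperplane [x i = a i] of the
    box, so that this sum vanishes; but its term at [m] does not.  A nonempty
    set without isolated points on lines in any of [N] directions has at least
    [2 ^ N] elements: cut it in two along one direction and induct. *)
Require Import Defs.
From mathcomp Require Import all_boot all_order all_algebra finmap.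
From mathcomp.multinomials Require Import mpoly.

Import GRing.Theory.

Local Open Scope fset_scope.
Local Open Scope ring_scope.

(** The directions form a set [D] so that the induction can drop one: after cutting along [i], each
    half keeps its line partners only in directions other than [i]. *)
Lemma leq_exp2_size_lines (n : nat) (D : {set 'I_n}) (s : seq 'X_{1..n}) :
  s != [::] ->
  (forall i m, i \in D -> m \in s -> exists m' : 'X_{1..n},
     [/\ m' \in s, m' i != m i & forall j, j != i -> m' j = m j]) ->
  (2 ^ #|D| <= size s)%N.
Proof.
move: {2}#|D| (erefl #|D|) => d; elim: d D s => [|d IHd] D s cardD s0 lineP.
  by rewrite cardD lt0n size_eq0.
have /card_gt0P[i iD] : (0 < #|D|)%N by rewrite cardD.
have cardDi : #|D :\ i| = d by move: cardD; rewrite (cardsD1 i D) iD => -[].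
case: s s0 lineP => // m0 s' _; set s := m0 :: s' => lineP.
have half (p : pred 'X_{1..n}) : has p s ->
    (forall m m' : 'X_{1..n}, m' i = m i -> p m' = p m) ->
    (2 ^ d <= count p s)%N.
  move=> hasp pP; rewrite -size_filter -cardDi; apply: IHd => //.
    by rewrite -has_filter.
  move=> j m; rewrite !inE mem_filter => /andP[ji jD] /andP[pm ms].
  have [m' [m's m'j eqm]] := lineP j m jD ms.
  exists m'; split=> //; rewrite mem_filter m's (pP m) ?pm //.
  by apply: eqm; rewrite eq_sym.
have m0s : m0 \in s by rewrite mem_head.
have [m1 [m1s m1i _]] := lineP i m0 iD m0s.
(* The half [m i = m0 i] contains [m0]; its complement contains the partner [m1]. *)
rewrite cardD -(count_predC [pred m : 'X_{1..n} | m i == m0 i] s).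
rewrite expnS mul2n -addnn.
by apply: leq_add; apply: half => [|m m' /= -> //]; apply/hasP;
  [exists m0 => /= | exists m1].
Qed.

(** The elements of [A] are distinct, so their Vandermonde matrix is invertible; [w] is column [k]
    of its inverse. *)
Lemma exists_coef_weights (K : fieldType) (A : {fset K}) (k : nat) :
  (k < #|` A|)%N ->
  exists w : A -> K,
    forall l, (l < #|` A|)%N -> \sum_(x : A) w x * val x ^+ l = (l == k)%:R.
Proof.
rewrite cardfE => kA.
pose t : 'rV[K]_#|{: A}| := \row_j val (enum_val j).
pose V := Vandermonde #|{: A}| t.
have Vu : V \in unitmx.
  rewrite unitmxE det_Vandermonde unitfE.
  apply/prodf_neq0 => i _; apply/prodf_neq0 => j ij.
  rewrite !mxE subr_eq0 (inj_eq val_inj) (inj_eq enum_val_inj).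
  by apply: contraTneq ij => ->; rewrite ltnn.
exists (fun x => invmx V (enum_rank x) (Ordinal kA)) => l lA.
have := congr1 (fun M : 'M_ _ => M (Ordinal lA) (Ordinal kA)) (mulmxV Vu).
rewrite !mxE => /= <-.
rewrite (reindex _ (onW_bij _ (@enum_val_bij A))).
by apply: eq_bigr => j _; rewrite enum_valK !mxE mulrC.
Qed.

Lemma sum_box_weights (N : nat) (K : fieldType) (A : 'I_N -> {fset K})
    (f : {mpoly K[N]}) (w : forall i, A i -> K) :
  \sum_(g : fprod (fun i => A i : finType))
     (\prod_i w i (g i)) * f.@[fun i => val (g i)] =
  \sum_(m <- msupp f) f@_m * \prod_i \sum_(x : A i) w i x * val x ^+ m i.
Proof.
under eq_bigr do rewrite mevalE mulr_sumr.
rewrite exchange_big /=; apply: eq_bigr => m _.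
(* Distributivity is applied after moving the sums over the different types [A i] to a common tagged
   type. *)
pose F i := [ffun x : A i => w i x * val x ^+ m i].
under [in RHS]eq_bigr => i _.
  rewrite (eq_bigr (F i)) => [|x _]; last by rewrite ffunE.
  rewrite (big_tag (fun i => F i : A i -> K)); over.
rewrite bigA_distr_big_dep -big_fprod mulr_sumr.
apply: eq_bigr => g _; rewrite mulrCA -big_split /=; congr (_ * _).
by apply: eq_bigr => i _; rewrite ffunE.
Qed.

Lemma msupp_line_partner (N : nat) (K : fieldType) (A : 'I_N -> {fset K})
    (a : 'I_N -> K) (f : {mpoly K[N]}) :
  a \in box (fun i => A i `\ 0) ->
  (forall i : 'I_N, (mdegvar i f < #|` A i|)%N) ->
  absorbing f a (box A) ->
  forall i m, m \in msupp f -> exists m' : 'X_{1..N},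
    [/\ m' \in msupp f, m' i != m i & forall j, j != i -> m' j = m j].
Proof.
move=> /forallP aA degf absf i m mf.
have degm (p : 'X_{1..N}) j : p \in msupp f -> (p j < #|` A j|)%N.
  move=> pf; apply: leq_ltn_trans (degf j).
  exact: leq_bigmax_seq.
have aAi : a i \in A i by have /fsetD1P[] := aA i.
have ai0 : a i != 0 by have /fsetD1P[] := aA i.
have /fin_all_exists[w wP] j : exists w : A j -> K,
    (j = i -> forall x, val x != a i -> w x = 0) /\
    forall l, (l < #|` A j|)%N -> \sum_(x : A j) w x * val x ^+ l =
      if j == i then a i ^+ l else (l == m j)%:R.
  have [->|ji] := eqVneq j i.
    exists (fun x => (val x == a i)%:R); split=> [_ x /negPf-> // | l _].
    rewrite (bigD1 [` aAi]) //= eqxx mul1r big1 ?addr0 // => x xa.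
    by rewrite -[a i]/(val [` aAi]) val_eqE (negPf xa) mul0r.
  have [v vP] := exists_coef_weights _ _ _ (degm m j mf).
  by exists v; split=> // /eqP; rewrite (negPf ji).
(* Each term on the box side vanishes: either [g i] is [a i] and [f] is absorbing, or the weight
   [w i (g i)] is zero. *)
have := sum_box_weights _ _ A f w; rewrite big1 => [|g _]; last first.
  have [gi|gi] := eqVneq (val (g i)) (a i).
    rewrite absf ?mulr0 //; last by exists i.
    by apply/forallP => j; apply: valP.
  by rewrite (bigD1 i) //= (wP i).1 // !mul0r.
pose partner (p : 'X_{1..N}) :=
  (p i != m i) && [forall j, (j != i) ==> (p j == m j)].
have [/hasP[p pf /andP[pi /forall_inP eqp]] _|/hasPn alone] :=
    boolP (has partner (msupp f)).
  by exists p; split=> // j ji; apply/eqP/eqp.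
have ne_off p : p \in msupp f -> p != m ->
    exists2 j, j != i & p j != m j.
  move=> pf pm; have := alone p pf; rewrite /partner negb_and negbK.
  case/orP=> [/eqP pi|]; last by rewrite negb_forall_in => /exists_inP.
  apply/exists_inP; apply: contraNT pm.
  rewrite negb_exists_in => /forall_inP eqp.
  apply/eqP/mnmP => j; have [-> //|ji] := eqVneq j i.
  by have := eqp j ji; rewrite negbK => /eqP.
(* Without a partner, every other [p] of the support has a zero factor in some direction [j != i];
   only [f@_m * a i ^+ m i] remains. *)
rewrite (bigD1_seq m) ?msupp_uniq //=.
rewrite [X in _ + X]big1_seq => [|p /andP[pm pf]]; last first.
  have [j ji pj] := ne_off p pf pm.
  by rewrite (bigD1 j) //= (wP j).2 ?degm // (negPf ji) (negPf pj) mul0r mulr0.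
rewrite addr0 (bigD1 i) //= (wP i).2 ?degm // eqxx big1 => [|j ji]; last first.
  by rewrite (wP j).2 ?degm // (negPf ji) eqxx.
move/esym/eqP; rewrite mulr1 mulf_eq0 expf_eq0 (negPf ai0) andbF orbF.
by rewrite mcoeff_eq0 mf.
Qed.

Theorem theorem5p1 (N : nat) (K : fieldType) (A : 'I_N -> {fset K})
    (a : 'I_N -> K) (f : {mpoly K[N]}) :
  (0 < N)%N ->
  a \in box (fun i => A i `\ 0) ->
  (forall i : 'I_N, (mdegvar i f < #|` A i|)%N) ->
  absorbing f a (box A) ->
  (exists2 b : 'I_N -> K, b \in box A & f.@[b] != 0) ->
  (2 ^ N <= nmonomials f)%N.
Proof.
move=> _ aA degf absf [b _ fb0]; rewrite -[N in (2 ^ N)%N]card_ord -cardsT.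
apply: leq_exp2_size_lines => [|i m _]; last first.
  exact: (msupp_line_partner _ _ A a).
by apply: contra_neq fb0 => s0; rewrite mevalE s0 big_nil.
Qed.
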